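(* Let $\Lambda$ be a finite set and let $Q=(q(x,y))_{x,y\in\Lambda\cup\{0\}}$ be the rate matrix of an irreducible continuous-time Markov jump process on $\Lambda\cup\{0\}$, such that the process on $\Lambda$ with rates $\{q(x,y):x,y\in\Lambda\}$ is also irreducible. For $N\ge2$ let $(\xi_t)_{t\ge0}$ be the Fleming–Viot process on $\Lambda^N$ with generator $$\mathcal{L}^N f(\xi)=\sum_{i=1}^N\sum_{x\in\Lambda\setminus\{\xi(i)\}}\Bigl[q(\xi(i),x)+q(\xi(i),0)\frac{\sum_{j\ne i}\mathbf 1_{\{\xi(j)=x\}}}{N-1}\Bigr]\bigl(f(\xi^{i,x})-f(\xi)\bigr),$$ ($\xi^{i,x}(i)=x$, $\xi^{i,x}(j)=\xi(j)$ for $j\ne i$), let $\mathbb E^N_\xi$ denote expectation for the process started at $\xi$, and let $\lambda^N$ be its unique stationary distribution. Let $m(\xi)$ be the empirical measure $m(\xi)=\frac1N\sum_{i=1}^N\delta_{\xi(i)}$. For a probability measure $\mu$ on $\Lambda$ let $$T_t\mu(x)=\frac{\sum_{y\in\Lambda}\mu(y)\exp(tQ)(y,x)}{1-\sum_{y\in\Lambda}\mu(y)\exp(tQ)(y,0)},\quad x\in\Lambda,$$ and let $\nu$ be the unique quasi-stationary distribution of $Q$, i.e. the unique probability measure on $\Lambda$ with $T_t\nu=\nu$ for all $t\ge0$. Then for every $t>0$, $$\lim_{N\to\infty}\sup_{\xi\in\Lambda^N}\mathbb E^N_\xi\bigl[\|m(\xi_t)-T_tm(\xi)\|\bigr]=0,$$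 and $$\lim_{N\to\infty}\int_{\Lambda^N}\|m(\xi)-\nu\|\,d\lambda^N(\xi)=0,$$ where $\|\mu-\nu\|=\sum_{x\in\Lambda}|\mu(x)-\nu(x)|$.
   Context: In the Fleming–Viot process, $N$ particles move independently in $\Lambda$ with rates $Q$, except that when a particle attempts to jump to $0$ it instead jumps instantaneously to the position of one of the other particles chosen uniformly at random. For finite $\Lambda$ this process is an irreducible Markov chain on the finite set $\Lambda^N$, hence has a unique stationary distribution $\lambda^N$. $T_t\mu$ is the law at time $t$ of the $Q$-process started from $\mu$, conditioned on not having hit $0$ by time $t$. Under the stated irreducibility assumptions a unique quasi-stationary distribution exists.
   Formalization: In T_t (hence also in the definition of ν), exp(tQ) is computed with 0 made absorbing (the row of 0 in Q set to zero), so T_tμ is the law conditioned on not having hit 0 by time t; with exp(tQ) for the irreducible Q taken literally the claim fails. *)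

(* Defs.v *)
From HB Require Import structures.
From mathcomp Require Import all_boot all_order all_algebra.
From mathcomp Require Import all_classical all_reals all_analysis.
Set Implicit Arguments. Unset Strict Implicit. Unset Printing Implicit Defensive.
Import Order.TTheory GRing.Theory Num.Theory.
Local Open Scope ring_scope.

Section MatExp.
Variables (R : realType) (T : finType).

Fixpoint mpow (A : T -> T -> R) (k : nat) : T -> T -> R :=
  match k with
  | 0 => fun x y => (x == y)%:R
  | k.+1 => fun x y => \sum_(z : T) mpow A k x z * A z y
  end.

Definition mexp (A : T -> T -> R) (t : R) : T -> T -> R :=
  fun x y => limn (fun n : nat => \sum_(k < n) t ^+ k / (k`!)%:R * mpow A k x y).

Definition is_rate_matrix (A : T -> T -> R) : Prop :=
  (forall x y, x != y -> 0 <= A x y) /\ (forall x, \sum_(y : T) A x y = 0).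

Definition irreducible_rates (A : T -> T -> R) : Prop :=
  forall x y, connect [rel a b | (a != b) && (0 < A a b)] x y.

Definition is_prob (mu : T -> R) : Prop :=
  (forall x, 0 <= mu x) /\ \sum_(x : T) mu x = 1.

Definition tvdist (mu nu : T -> R) : R := \sum_(x : T) `|mu x - nu x|.

End MatExp.

Section FV.
Variables (R : realType) (L : finType).
Local Notation state := (option L). (* None plays the role of the cemetery 0 *)

Definition absorbed (Q : state -> state -> R) : state -> state -> R :=
  fun x y => if x is Some _ then Q x y else 0.

(* T_t mu (x) = sum_y mu(y) e^{tQ}(y,x) / (1 - sum_y mu(y) e^{tQ}(y,0)),
   with 0 absorbing (law at time t conditioned on not having hit 0). *)
Definition Tt (Q : state -> state -> R) (t : R) (mu : L -> R) : L -> R :=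
  let P := mexp (absorbed Q) t in
  fun x => (\sum_(y : L) mu y * P (Some y) (Some x)) /
           (1 - \sum_(y : L) mu y * P (Some y) None).

Definition conf (N : nat) := {ffun 'I_N -> L}.

Definition upd (N : nat) (xi : conf N) (i : 'I_N) (x : L) : conf N :=
  [ffun j => if j == i then x else xi j].

Definition genFV (Q : state -> state -> R) (N : nat) (f : conf N -> R)
    (xi : conf N) : R :=
  \sum_(i < N) \sum_(x : L | x != xi i)
     (Q (Some (xi i)) (Some x)
      + Q (Some (xi i)) None *
          ((\sum_(j < N | j != i) (xi j == x)%:R) / (N.-1)%:R))
     * (f (upd xi i x) - f xi).

Definition genFVmx (Q : state -> state -> R) (N : nat) : conf N -> conf N -> R :=
  fun xi eta => genFV Q (fun zeta => (zeta == eta)%:R) xi.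

Definition expFV (Q : state -> state -> R) (N : nat) (t : R) (xi : conf N)
    (F : conf N -> R) : R :=
  \sum_(eta : conf N) mexp (@genFVmx Q N) t xi eta * F eta.

Definition is_stationaryFV (Q : state -> state -> R) (N : nat)
    (lam : conf N -> R) : Prop :=
  is_prob lam /\ forall f : conf N -> R, \sum_(xi : conf N) lam xi * genFV Q f xi = 0.

Definition empirical (N : nat) (xi : conf N) : L -> R :=
  fun x => (\sum_(i < N) (xi i == x)%:R) / N%:R.

End FV.

(* Main.v *)
(* Write P_s for the sub-Markov semigroup of Q killed at 0.  For a test function
   phi the map r_s(xi) = m(xi)(P_s phi) / m(xi)(P_s 1) = T_s m(xi)(phi) is a
   ratio of two averages over particles.  Applying the Fleming-Viot generator L
   to it, the first order terms give exactly the s-derivative of r_s, and the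
   remainder, as well as the carre du champ of r_s, is O(1/N) uniformly in xi.
   Hence with c = r_t(xi) the function
     s |-> E_xi[(r_s(xi_(t-s)) - c)^2]
   has derivative O(1/N); it vanishes at s = t, so its value at s = 0, which is
   the mean square error E_xi[(m(xi_t)(phi) - T_t m(xi)(phi))^2], is O(t/N).
   For the second limit, T_t mu -> nu uniformly in mu: reversing P_1 in time
   with respect to nu gives a stochastic matrix with positive entries, which
   contracts the oscillation of the density of mu P_n with respect to nu.
   Stationarity of lambda^N then reduces the claim to the first limit at one
   large time t. *)
Require Import Defs.
From HB Require Import structures.
From mathcomp Require Import all_boot all_order all_algebra.
From mathcomp Require Import all_classical all_reals all_analysis.
From mathcomp Require Import ring lra.
Set Implicit Arguments.
Unset Strict Implicit.
Unset Printing Implicit Defensive.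
Import Order.TTheory GRing.Theory Num.Theory.
Import numFieldNormedType.Exports.
Local Open Scope classical_set_scope.
Local Open Scope ring_scope.

(** * Exponentials of rate matrices *)

Section ExponentialSeries.
Variable R : realType.
Implicit Types (c : nat -> R) (t C D : R).

(** Domination by [D] times the exponential series at [C * |t|]. Entries of matrix powers satisfy
    such a geometric bound, and shifting [c] preserves it. *)
Lemma is_cvg_exp_series c C D t : (forall k, `|c k| <= D * C ^+ k) ->
  cvgn (pseries (fun k => c k / k`!%:R) t).
Proof.
move=> hc; apply: normed_cvg.
apply: (@series_le_cvg _ _ (fun k => D * exp_coeff (C * `|t|) k)).
- by move=> n /=.
- move=> n; have := le_trans (normr_ge0 _) (hc n).
  move=> h; rewrite /exp_coeff /= exprMn mulrA mulrA.
  by rewrite divr_ge0 // mulr_ge0.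
- move=> n; rewrite /exp_coeff /= !normrM normfV normr_nat normrX exprMn.
  rewrite [X in X <= _]mulrAC !mulrA ler_wpM2r ?invr_ge0 //.
  by rewrite ler_wpM2r.
- exact: is_cvg_seriesZ (is_cvg_series_exp_coeff _).
Qed.

Lemma pseries_diffs_exp c :
  pseries_diffs (fun k => c k / k`!%:R) = (fun k => c k.+1 / k`!%:R).
Proof.
apply/funext => k; rewrite /pseries_diffs factS natrM invfM.
by rewrite mulrCA mulVKf // pnatr_eq0.
Qed.

Lemma is_derive_exp_series c C D t : (forall k, `|c k| <= D * C ^+ k) ->
  is_derive t (1 : R) (fun s => limn (pseries (fun k => c k / k`!%:R) s))
    (limn (pseries (fun k => c k.+1 / k`!%:R) t)).
Proof.
move=> hc.
have hS (D' : R) c' : (forall k, `|c' k| <= D' * C ^+ k) ->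
    forall k, `|c' k.+1| <= (D' * C) * C ^+ k.
  by move=> h k; rewrite -mulrA -exprS.
have h1 := hS _ _ hc; have h2 := hS _ _ h1.
rewrite -pseries_diffs_exp.
(* Term-by-term differentiation requires the series and its first two formal derivatives to converge
   at a point beyond [|t|]; they are the exponential series of [c] shifted by 0, 1 and 2. *)
apply: (@pseries_snd_diffs _ _ (`|t| + 1)).
- exact: is_cvg_exp_series hc.
- by rewrite pseries_diffs_exp; exact: is_cvg_exp_series h1.
- by rewrite !pseries_diffs_exp; exact: is_cvg_exp_series h2.
- by rewrite [ltRHS]ger0_norm ?ltrDl// addr_ge0.
Qed.

End ExponentialSeries.

(** * Derivatives of finite sums and a mean value inequality *)

Section Calculus.
Variable R : realType.

Lemma is_derive_sumT (T : finType) (P : pred T) (f : T -> R -> R) (df : T -> R)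
    (t : R) : (forall i, P i -> is_derive t (1 : R) (f i) (df i)) ->
  is_derive t (1 : R) (fun s => \sum_(i | P i) f i s) (\sum_(i | P i) df i).
Proof.
move=> h.
rewrite [X in is_derive _ _ X](_ : _ = \sum_(i | P i) f i); last first.
  by apply/funext => s; rewrite fct_sumE.
elim/big_ind2 : _ => //; first exact: is_derive_cst.
by move=> *; exact: is_deriveD.
Qed.

Lemma is_derive_bound (f df : R -> R) (a b C : R) : a <= b ->
  (forall s, a <= s <= b -> is_derive s (1 : R) f (df s)) ->
  (forall s, a <= s <= b -> `|df s| <= C) -> `|f b - f a| <= C * (b - a).
Proof.
move=> ab hd hC.
have ctn : {within `[a, b], continuous f}.
  apply: derivable_within_continuous => s; rewrite in_itv /= => hs.
  by have [] := hd s hs.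
have [c hc ->] : exists2 c, a <= c <= b & f b - f a = df c * (b - a).
  have hd' s : s \in `]a, b[%R -> is_derive s (1 : R) f (df s).
    by rewrite in_itv /= => /andP[h1 h2]; apply: hd; rewrite !ltW.
  have [c] := MVT_segment ab hd' ctn.
  by rewrite in_itv /= => hc e; exists c.
by rewrite normrM [`|b - a|]ger0_norm ?subr_ge0// ler_wpM2r ?subr_ge0// hC.
Qed.

End Calculus.

(** * Kolmogorov equations, semigroup property and positivity of matrix exponentials *)

Section MatrixExponential.
Variables (R : realType) (T : finType).
Implicit Types (A : T -> T -> R) (x y : T) (s t : R).

Definition msize A : R := \sum_(x : T) \sum_(y : T) `|A x y|.

Lemma msize_ge A x y : `|A x y| <= msize A.
Proof.
rewrite /msize (bigD1 x) //= (bigD1 y) //= -addrA lerDl.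
by rewrite addr_ge0 ?sumr_ge0 // => i _; rewrite ?sumr_ge0.
Qed.

Lemma msize_ge0 A : 0 <= msize A.
Proof. by rewrite /msize sumr_ge0// => x _; rewrite sumr_ge0. Qed.

Lemma mpow_bound A k x y : `|mpow A k x y| <= msize A ^+ k.
Proof.
elim: k y => [|k IH] y /=.
  by rewrite expr0; case: (x == y); rewrite ?normr0 ?normr1.
apply: le_trans (ler_norm_sum _ _ _) _.
rewrite exprSr; apply: (@le_trans _ _ (\sum_z msize A ^+ k * `|A z y|)).
  by apply: ler_sum => z _; rewrite normrM ler_wpM2r.
rewrite -mulr_sumr ler_wpM2l ?exprn_ge0 ?msize_ge0//.
apply: ler_sum => z _; rewrite (bigD1 y) //= lerDl.
by rewrite sumr_ge0.
Qed.

(** [mpow] multiplies on the right; the left-handed recursion is what yields the backward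
    equation. *)
Lemma mpowSl A k x y : mpow A k.+1 x y = \sum_z A x z * mpow A k z y.
Proof.
elim: k y => [|k IH] y.
  rewrite /= (bigD1 x) //= eqxx mul1r big1 ?addr0 => [|z /negPf zx].
    rewrite (bigD1 y) //= eqxx mulr1 big1 ?addr0// => z /negPf zy.
    by rewrite zy mulr0.
  by rewrite eq_sym zx mul0r.
transitivity (\sum_z mpow A k.+1 x z * A z y) => //.
under eq_bigr => z _ do rewrite IH mulr_suml.
rewrite exchange_big; apply: eq_bigr => z _ /=.
by rewrite mulr_sumr; apply: eq_bigr => w _; rewrite mulrA.
Qed.

Lemma mexpE A t x y :
  mexp A t x y = limn (pseries (fun k => mpow A k x y / k`!%:R) t).
Proof.
rewrite /mexp; congr (limn _); apply/funext => n.
rewrite /pseries /series /= big_mkord; apply: eq_bigr => k _.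
by rewrite mulrC [t ^+ _ / _]mulrC mulrA.
Qed.

Let mb A x y k : `|mpow A k x y| <= 1 * msize A ^+ k.
Proof. by rewrite mul1r mpow_bound. Qed.

Lemma mexp_cvg A t x y :
  pseries (fun k => mpow A k x y / k`!%:R) t @ \oo --> mexp A t x y.
Proof.
by rewrite mexpE; exact: (@is_cvg_exp_series _ _ _ _ t (mb A x y)).
Qed.

(** Forward equation: the differentiated series has coefficients [mpow A k.+1], and the finite sum
    over [z] commutes with the limit. *)
Lemma is_derive_mexp A t x y : is_derive t (1 : R) (fun s => mexp A s x y)
  (\sum_z mexp A t x z * A z y).
Proof.
have := @is_derive_exp_series _ _ _ _ t (mb A x y).
rewrite [X in is_derive _ _ X _](_ : _ = (fun s => mexp A s x y)); last first.
  by apply/funext => s; rewrite mexpE.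
move=> h; apply: is_derive_eq h _; apply: cvg_lim => //.
rewrite [X in X @ \oo](_ : _ = (fun n => \sum_z
  pseries (fun k => mpow A k x z / k`!%:R) t n * A z y)).
  apply: cvg_big => [|z _]; first exact: add_continuous.
  by apply: cvgMr_tmp; exact: mexp_cvg.
apply/funext => n; rewrite /pseries /series /=.
under [RHS]eq_bigr => z _ do rewrite mulr_suml.
rewrite exchange_big; apply: eq_bigr => k _ /=.
rewrite !mulr_suml; apply: eq_bigr => z _.
by rewrite (mulrAC _ (A z y)) (mulrAC _ (A z y)).
Qed.

(** Backward equation, obtained the same way from [mpowSl]. *)
Lemma is_derive_mexpl A t x y : is_derive t (1 : R) (fun s => mexp A s x y)
  (\sum_z A x z * mexp A t z y).
Proof.
have := @is_derive_exp_series _ _ _ _ t (mb A x y).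
rewrite [X in is_derive _ _ X _](_ : _ = (fun s => mexp A s x y)); last first.
  by apply/funext => s; rewrite mexpE.
move=> h; apply: is_derive_eq h _; apply: cvg_lim => //.
rewrite [X in X @ \oo](_ : _ = (fun n => \sum_z
  A x z * pseries (fun k => mpow A k z y / k`!%:R) t n)).
  apply: cvg_big => [|z _]; first exact: add_continuous.
  by apply: cvgMl_tmp; exact: mexp_cvg.
apply/funext => n; rewrite /pseries /series.
under [RHS]eq_bigr => z _ do rewrite mulr_sumr.
rewrite exchange_big; apply: eq_bigr => k _.
transitivity (mpow A k.+1 x y / k`!%:R * t ^+ k) => //.
by rewrite mpowSl !mulr_suml; apply: eq_bigr => z _; rewrite !mulrA.
Qed.

Lemma mexp0 A x y : mexp A 0 x y = (x == y)%:R.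
Proof.
rewrite mexpE; apply: cvg_lim => //; rewrite -(cvg_shiftS _) /=.
rewrite [X in X @ \oo](_ : _ = cst (x == y)%:R); first exact: cvg_cst.
apply/funext => n; rewrite /pseries /series /= big_nat_recl //=.
rewrite fact0 divr1 expr0 mulr1 big1 ?addr0// => k _.
by rewrite exprS mul0r mulr0.
Qed.

Lemma is_derive_mexp_rev A t s x y :
  is_derive s (1 : R) (fun s => mexp A (t - s) x y)
    (- \sum_z mexp A (t - s) x z * A z y).
Proof.
have h1 : is_derive s (1 : R) (fun s => t - s) (- 1).
  by apply: is_derive_eq; ring.
have := is_derive_mexp A (t - s) x y => h2.
have := @is_derive1_comp _ (fun s => mexp A s x y) (fun s => t - s) _ _ _ h2 h1.
by move=> h; apply: is_derive_eq h _; rewrite mulrN1.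
Qed.

(* The derivative only involves the defect F' - A F, so it vanishes when F
   solves F' = A F. *)
Lemma is_derive_duhamel A (F : R -> T -> R) (dF : T -> R) t s x :
  (forall y, is_derive s (1 : R) (F ^~ y) (dF y)) ->
  is_derive s (1 : R) (fun s => \sum_y mexp A (t - s) x y * F s y)
    (\sum_y mexp A (t - s) x y * (dF y - \sum_z A y z * F s z)).
Proof.
move=> hF.
have -> : \sum_y mexp A (t - s) x y * (dF y - \sum_z A y z * F s z) =
  \sum_y (mexp A (t - s) x y * dF y
    - F s y * \sum_z mexp A (t - s) x z * A z y).
  rewrite sumrB; under eq_bigr => y _ do rewrite mulrBr.
  rewrite sumrB; congr (_ - _).
  under eq_bigr => y _ do rewrite mulr_sumr.
  under [RHS]eq_bigr => y _ do rewrite mulr_sumr.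
  rewrite exchange_big; apply: eq_bigr => y _; apply: eq_bigr => z _.
  by rewrite /=; ring.
apply: is_derive_sumT => y _.
have h1 := is_derive_mexp_rev A t s x y.
have := is_deriveM h1 (hF y) => h; apply: is_derive_eq h _.
by rewrite /GRing.scale /= mulrN.
Qed.

(** The Duhamel functional is constant when F' = A F; its values at [s = t] and [s = 0] are the two
    sides. *)
Lemma mexp_unique A (F : R -> T -> R) :
  (forall s y, is_derive s (1 : R) (F ^~ y) (\sum_z A y z * F s z)) ->
  forall t x, F t x = \sum_y mexp A t x y * F 0 y.
Proof.
move=> hF t x; pose g s := \sum_y mexp A (t - s) x y * F s y.
have : g t = g 0.
  apply: is_derive_0_is_cst => s.
  have := is_derive_duhamel A t x (hF s) => h; apply: is_derive_eq h _.
  by rewrite big1 // => y _; rewrite subrr mulr0.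
rewrite /g subrr subr0 => <-; rewrite (bigD1 x) //= mexp0 eqxx mul1r.
by rewrite big1 ?addr0// => y yx; rewrite mexp0 eq_sym (negPf yx) mul0r.
Qed.

(** As functions of [s], the entries at time [s + t] solve the backward equation with the
    exponential at time [t] as initial value. *)
Lemma mexpD A s t x y : mexp A (s + t) x y = \sum_z mexp A s x z * mexp A t z y.
Proof.
have := @mexp_unique A (fun s z => mexp A (s + t) z y) _ s x.
rewrite add0r; apply=> {}s z.
have h1 : is_derive s (1 : R) (fun s => s + t) 1.
  by apply: is_derive_eq; ring.
have h2 := is_derive_mexpl A (s + t) z y.
have := @is_derive1_comp _ (fun s => mexp A s z y) (fun s => s + t) _ _ _ h2 h1.
by rewrite mulr1.
Qed.

Lemma mexp_row A (v : T -> R) : (forall x, \sum_y A x y * v y = 0) ->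
  forall t x, \sum_y mexp A t x y * v y = v x.
Proof.
move=> h t x; apply/esym/(@mexp_unique A (fun=> v)) => s y.
by rewrite h; exact: is_derive_cst.
Qed.

(** By the backward equation v exp(sA) has derivative v A exp(sA) = 0. This carries stationarity
    from a generator to its semigroup. *)
Lemma mexp_stationary A (v : T -> R) : (forall y, \sum_x v x * A x y = 0) ->
  forall t y, \sum_x v x * mexp A t x y = v y.
Proof.
move=> h t y; pose g s := \sum_x v x * mexp A s x y.
have -> : v y = g 0.
  rewrite /g (bigD1 y) //= mexp0 eqxx mulr1 big1 ?addr0// => x /negPf xy.
  by rewrite mexp0 xy mulr0.
apply: (@is_derive_0_is_cst _ g) => s.
have -> : 0 = \sum_x v x * \sum_z A x z * mexp A s z y.
  under eq_bigr do rewrite mulr_sumr.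
  rewrite exchange_big big1 //= => z _.
  by under eq_bigr do rewrite mulrA; rewrite -mulr_suml h mul0r.
apply: is_derive_sumT => x _.
have h2 := is_derive_mexpl A s x y.
exact: is_deriveZ.
Qed.

(* Uniformization: a rate matrix shifted by a multiple of the identity has
   nonnegative entries, so positivity can be read off the exponential series. *)
Lemma mexp_shift A (c : R) t x y :
  mexp A t x y =
  expR (- (c * t)) * mexp (fun x y => A x y + c * (x == y)%:R) t x y.
Proof.
pose B := fun x y => A x y + c * (x == y)%:R; rewrite -/B.
(* The damped exponential of [B] solves F' = A F, so uniqueness identifies it with the exponential
   of [A]. *)
pose F s x := expR (- (c * s)) * mexp B s x y.
have FE s z : is_derive s (1 : R) (F ^~ z) (\sum_w A z w * F s w).
  have h1 : is_derive s (1 : R) (fun s => expR (- (c * s)))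
      (expR (- (c * s)) * - c).
    have h : is_derive s (1 : R) (fun s => - (c * s)) (- c).
      by apply: is_derive_eq; rewrite /GRing.scale /=; ring.
    exact: is_derive1_comp.
  have h2 := is_derive_mexpl B s z y.
  have := is_deriveM h1 h2 => h; apply: is_derive_eq h _.
  rewrite /GRing.scale /=.
  have -> : \sum_w B z w * mexp B s w y =
      \sum_w A z w * mexp B s w y + c * mexp B s z y.
    under eq_bigr => w _ do rewrite /B mulrDl.
    rewrite big_split /=; congr (_ + _).
    rewrite (bigD1 z) //= eqxx mulr1 big1 ?addr0 // => w /negPf wz.
    by rewrite eq_sym wz mulr0 mul0r.
  rewrite /F; under [RHS]eq_bigr => w _ do rewrite mulrCA.
  rewrite -mulr_sumr mulrDr -addrA (_ : _ * (c * _) + _ = 0) ?addr0//.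
  by rewrite mulrN mulrN mulrCA mulrA mulrC [expR _ * c]mulrC subrr.
rewrite -/(F t x) (mexp_unique FE) (bigD1 y) //= big1 ?addr0 => [|z zy].
  by rewrite /F mulr0 oppr0 expR0 mexp0 eqxx !mulr1.
by rewrite /F [mexp B 0 _ _]mexp0 (negPf zy) !mulr0.
Qed.

Lemma mpow_ge0 A : (forall x y, 0 <= A x y) -> forall k x y, 0 <= mpow A k x y.
Proof.
move=> h; elim=> [|k IH] x y /=; first by case: eqP.
by apply: sumr_ge0 => z _; apply: mulr_ge0.
Qed.

Lemma mexp_ge_term A k t x y : (forall x y, 0 <= A x y) -> 0 <= t ->
  mpow A k x y / k`!%:R * t ^+ k <= mexp A t x y.
Proof.
move=> hA t0.
have h0 j : 0 <= mpow A j x y / j`!%:R * t ^+ j.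
  by rewrite mulr_ge0 ?exprn_ge0 // divr_ge0 ?mpow_ge0.
have hc := @mexp_cvg A t x y.
rewrite -(cvg_lim _ hc)//.
apply: le_trans (nondecreasing_cvgn_le _ _ k.+1).
- by rewrite /pseries /series /= big_nat_recr //= lerDr sumr_ge0.
- by apply: nondecreasing_series => n _ _; exact: h0.
- by apply/cvg_ex; eexists; exact: hc.
Qed.

Section RateMatrix.
Variable A : T -> T -> R.
Hypothesis hA : is_rate_matrix A.

Let B := fun x y => A x y + msize A * (x == y)%:R.

Let B_ge0 x y : 0 <= B x y.
Proof.
rewrite /B; case: (eqVneq x y) => [<-|xy]; last first.
  by rewrite mulr0 addr0; apply: hA.1.
by rewrite mulr1 addrC -lerBlDr sub0r (le_trans (ler_norm _))// normrN msize_ge.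
Qed.

Lemma mexp_ge0 t x y : 0 <= t -> 0 <= mexp A t x y.
Proof.
move=> t0; rewrite (mexp_shift _ (msize A)) mulr_ge0 ?expR_ge0//.
apply: le_trans (mexp_ge_term 0 x y B_ge0 t0).
by rewrite mulr_ge0 ?exprn_ge0 // divr_ge0 ?mpow_ge0.
Qed.

(** The zeroth term of the uniformized series already gives this bound, which later keeps survival
    probabilities away from 0. *)
Lemma mexp_diag_ge t x : 0 <= t -> expR (- (msize A * t)) <= mexp A t x x.
Proof.
move=> t0; rewrite [leRHS](mexp_shift _ (msize A)) ler_peMr ?expR_ge0//.
apply: le_trans (mexp_ge_term 0 x x B_ge0 t0).
by rewrite /= eqxx fact0 expr0 divr1 mulr1.
Qed.

Lemma mexp_sum1 t x : \sum_y mexp A t x y = 1.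
Proof.
have := @mexp_row A (fun=> 1) _ t x.
under eq_bigr do rewrite mulr1; apply=> y.
by under eq_bigr do rewrite mulr1; exact: hA.2.
Qed.

(** Along a path of positive rates some power of the nonnegative matrix [B] is positive at the
    endpoints, and a single positive term of the series suffices. *)
Lemma mexp_gt0 t x y : 0 < t ->
  connect [rel a b | (a != b) && (0 < A a b)] x y -> 0 < mexp A t x y.
Proof.
move=> t0 /connectP [p hp ->] {y}.
have [k hk] : exists k, 0 < mpow B k x (last x p).
  elim/last_ind: p hp => [_|p z IH]; first by exists 0%N; rewrite /= eqxx.
  rewrite rcons_path last_rcons => /andP[/IH [k hk] /andP[ne h]].
  exists k.+1 => /=; rewrite (bigD1 (last x p)) //=.
  apply: ltr_pwDl; first by rewrite mulr_gt0 // /B (negPf ne) mulr0 addr0.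
  by rewrite sumr_ge0// => w _; rewrite mulr_ge0 ?mpow_ge0.
rewrite (mexp_shift _ (msize A)) mulr_gt0 ?expR_gt0//.
apply: lt_le_trans (mexp_ge_term k _ _ B_ge0 (ltW t0)).
by rewrite mulr_gt0 ?exprn_gt0 // divr_gt0 // ltr0n fact_gt0.
Qed.

End RateMatrix.

End MatrixExponential.

(** * Convergence to the quasi-stationary distribution *)

Lemma sum_option (V : nmodType) (T : finType) (F : option T -> V) :
  \sum_z F z = F None + \sum_x F (Some x).
Proof.
rewrite (bigD1 None) //=; congr (_ + _).
rewrite (reindex_omap Some id) /=; first by apply: eq_bigl => x; rewrite eqxx.
by case.
Qed.

Lemma pos_lower_bound (R : realType) (I : finType) (f : I -> R) :
  (forall i, 0 < f i) -> exists2 e : R, 0 < e < 1 & forall i, e <= f i.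
Proof.
move=> f0; pose S := \sum_i (f i)^-1.
have S0 : 0 <= S by apply: sumr_ge0 => i _; rewrite invr_ge0 ltW.
have S2 : 0 < 2 + S by lra.
(* The sum of all inverses dominates each of them, also when [I] is empty; the 2 pushes the bound
   strictly below 1. *)
exists (2 + S)^-1; first by rewrite invr_gt0 S2 invf_lt1 //; lra.
move=> i; rewrite invf_ple ?posrE //.
rewrite /S (bigD1 i) //= addrCA lerDl addr_ge0 //.
by apply: sumr_ge0 => j _; rewrite invr_ge0 ltW.
Qed.

(** * Contraction towards the left eigenvector of a positive matrix *)

Section Contraction.
Variables (R : realType) (L : finType) (P : L -> L -> R) (nu : L -> R).
Variable rho : R.
Hypothesis P_gt0 : forall x y, 0 < P x y.
Hypothesis nu_prob : is_prob nu.
Hypothesis nu_eigen : forall y, \sum_x nu x * P x y = rho * nu y.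

Let exL : exists x, 0 < nu x.
Proof.
case: (boolP [exists x, 0 < nu x]) => [/existsP //|/existsPn h].
have := nu_prob.2; rewrite big1 => [/eqP|x _]; first by rewrite eq_sym oner_eq0.
by apply/eqP; rewrite eq_le nu_prob.1 leNgt h.
Qed.

Let nuP_gt0 y : 0 < \sum_x nu x * P x y.
Proof.
have [x hx] := exL; rewrite (bigD1 x) //= ltr_pwDl ?mulr_gt0//.
by apply: sumr_ge0 => z _; rewrite mulr_ge0 ?nu_prob.1 // ltW.
Qed.

Let rho_gt0 : 0 < rho.
Proof.
have [x hx] := exL; have := nuP_gt0 x.
by rewrite nu_eigen pmulr_lgt0.
Qed.

(** A nonnegative nonzero left eigenvector of a positive matrix is positive everywhere, so densities
    with respect to [nu] make sense. *)
Let nu_gt0 x : 0 < nu x.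
Proof. by have := nuP_gt0 x; rewrite nu_eigen pmulr_rgt0. Qed.

(* The Doob transform of the time reversal of P with respect to nu is a
   stochastic matrix with positive entries, and it maps the density of mu P^n
   with respect to rho^n nu to that of mu P^(n+1). *)
Let K x y := nu y * P y x / (rho * nu x).

Let K_gt0 x y : 0 < K x y.
Proof. by rewrite /K divr_gt0 ?mulr_gt0. Qed.

Let K_sum1 x : \sum_y K x y = 1.
Proof.
by rewrite -mulr_suml nu_eigen divff // mulf_neq0 // gt_eqF.
Qed.

(** Doeblin's argument: after subtracting the minimum of [f], attained at [z0], both averages are
    nonnegative, and the one at [x] puts mass at least [e] on [z0], where the shifted function
    vanishes. *)
Lemma osc_contraction (e D : R) (f : L -> R) : 0 <= D ->
  (forall x y, e <= K x y) -> (forall x y, f x - f y <= D) ->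
  forall x y, \sum_z K x z * f z - \sum_z K y z * f z <= (1 - e) * D.
Proof.
move=> D0 he hf x y.
have [z0 hz0] : exists z0, forall z, f z0 <= f z.
  have [w _] := exL.
  by case: (arg_minP f (isT : xpredT w)) => z0 _ h; exists z0 => z; apply: h.
have shift u : \sum_z K u z * f z = \sum_z K u z * (f z - f z0) + f z0.
  under [in RHS]eq_bigr do rewrite mulrBr.
  by rewrite sumrB -[X in _ - X + _]mulr_suml K_sum1 mul1r subrK.
rewrite !shift opprD addrACA subrr addr0.
apply: (@le_trans _ _ (\sum_z K x z * (f z - f z0))).
  rewrite gerBl; apply: sumr_ge0 => z _.
  by rewrite mulr_ge0 ?subr_ge0 // ltW.
apply: (@le_trans _ _ (\sum_(z | z != z0) K x z * D)).
  rewrite (bigD1 z0) //= subrr mulr0 add0r; apply: ler_sum => z _.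
  by rewrite ler_wpM2l // ltW.
rewrite -mulr_suml ler_wpM2r //.
rewrite lerBrDr; have := K_sum1 x; rewrite (bigD1 z0) //= => <-.
by rewrite addrC lerD.
Qed.

Lemma eigen_contraction : exists C q : R, 0 <= q < 1 /\
  forall r : nat -> L -> R, is_prob (r 0%N) ->
    (forall n y, r n.+1 y = \sum_x r n x * P x y) ->
  forall n, tvdist (fun x => r n.+1 x / \sum_y r n.+1 y) nu <= C * q ^+ n.+1.
Proof.
have [e /andP[e0 e1] heK] := pos_lower_bound (fun xy : L * L => K_gt0 xy.1 xy.2).
have he x y : e <= K x y by exact: (heK (x, y)).
pose D := \sum_x (nu x)^-1.
have D_ge x : (nu x)^-1 <= D.
  rewrite /D (bigD1 x) //= lerDl; apply: sumr_ge0 => y _.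
  by rewrite invr_ge0 ltW.
have D0 : 0 <= D by have [x hx] := exL; apply: le_trans (D_ge x); rewrite invr_ge0 ltW.
have q0 : 0 <= 1 - e by rewrite subr_ge0 ltW.
(* [D] bounds the initial oscillation of the density and [e] bounds the normalizing mass from below,
   the latter only after one step: hence the index [n.+1]. *)
exists (D / e), (1 - e); split; first by rewrite q0 /= ltrBlDr ltrDl.
move=> r [r0 r1] hr.
pose f n x := r n x / (rho ^+ n * nu x).
have rE n x : r n x = rho ^+ n * (nu x * f n x).
  by rewrite mulrA /f mulrC divfK // mulf_neq0 ?expf_neq0 ?gt_eqF.
have fS n x : f n.+1 x = \sum_y K x y * f n y.
  rewrite /f hr mulr_suml; apply: eq_bigr => y _; rewrite /K exprS.
  have h1 := gt_eqF (nu_gt0 y); have h2 := gt_eqF (nu_gt0 x).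
  have h3 := gt_eqF rho_gt0; have h4 := expf_neq0 n (negbT h3).
  by field; rewrite h1 h2 h3 h4.
have f_osc n x y : f n x - f n y <= (1 - e) ^+ n * D.
  elim: n x y => [|n IH] x y; last first.
    rewrite !fS exprS -mulrA; apply: osc_contraction => //.
    by rewrite mulr_ge0 // exprn_ge0.
  rewrite expr0 mul1r /f expr0 !mul1r; apply: le_trans (D_ge x).
  rewrite lerBlDr; apply: (@le_trans _ _ (nu x)^-1).
    rewrite ler_pdivrMr // mulVf ?gt_eqF // -r1 (bigD1 x) //= lerDl.
    by apply: sumr_ge0.
  by rewrite lerDl divr_ge0 // ltW.
(* Since [nu <= 1], the initial density dominates [r 0], which has mass 1, so one application of [K]
   lifts it above [e]; further averaging by [K] preserves this. *)
have f_ge n x : e <= f n.+1 x.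
  elim: n x => [|n IH] x.
    rewrite fS; apply: (@le_trans _ _ (\sum_y e * r 0%N y)).
      by rewrite -mulr_sumr r1 mulr1.
    apply: ler_sum => y _; apply: ler_pM => //; first exact: ltW.
    rewrite /f expr0 mul1r ler_peMr // invf_ge1 //.
    by rewrite -nu_prob.2 (bigD1 y) //= lerDl sumr_ge0 // => z _; apply: ltW.
  rewrite fS -[leLHS]mul1r -(K_sum1 x) mulr_suml.
  by apply: ler_sum => y _; rewrite ler_wpM2l // ltW.
move=> n; set s := \sum_y nu y * f n.+1 y.
have s_ge : e <= s.
  rewrite -[leLHS]mul1r -nu_prob.2 mulr_suml.
  by apply: ler_sum => y _; rewrite ler_wpM2l // ltW.
have s0 : 0 < s by exact: lt_le_trans s_ge.
have -> : \sum_y r n.+1 y = rho ^+ n.+1 * s.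
  by rewrite mulr_sumr; apply: eq_bigr => y _; rewrite rE.
rewrite /tvdist -[leRHS]mul1r -[X in _ <= X * _]nu_prob.2 mulr_suml.
apply: ler_sum => x _.
rewrite rE -mulf_div divff ?expf_neq0 ?gt_eqF // mul1r -mulrA.
rewrite -[X in _ - X]mulr1 -mulrBr normrM gtr0_norm // ler_pM2l //.
(* As [s] is the [nu]-average of the density, its deviation from [s] is an average of differences,
   each controlled by the oscillation. *)
have -> : f n.+1 x / s - 1 = (\sum_y nu y * (f n.+1 x - f n.+1 y)) / s.
  under eq_bigr do rewrite mulrBr.
  by rewrite sumrB -mulr_suml nu_prob.2 mul1r mulrBl divff // gt_eqF.
rewrite normrM normfV [`|s|]gtr0_norm // ler_pdivrMr //.
apply: le_trans (ler_norm_sum _ _ _) _.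
apply: (@le_trans _ _ (\sum_y nu y * ((1 - e) ^+ n.+1 * D))).
  apply: ler_sum => y _; rewrite normrM gtr0_norm // ler_pM2l //.
  by rewrite ler_norml f_osc andbT lerNl opprB f_osc.
rewrite -mulr_suml nu_prob.2 mul1r mulrC.
rewrite [leRHS](_ : _ = D * (1 - e) ^+ n.+1 * (s / e)); last by field; rewrite gt_eqF.
by rewrite ler_peMr ?mulr_ge0 ?exprn_ge0 // ler_pdivlMr // mul1r.
Qed.

End Contraction.

(** * The semigroup killed at the cemetery *)

Section Absorbed.
Variables (R : realType) (L : finType) (Q : option L -> option L -> R).
Hypothesis hQ : is_rate_matrix Q.

Definition subP (t : R) (y x : L) : R := mexp (absorbed Q) t (Some y) (Some x).

Lemma absorbed_rate : is_rate_matrix (absorbed Q).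
Proof.
split=> [[x|] y xy|[x|]] //=; [exact: hQ.1|exact: hQ.2|exact: big1].
Qed.

(** The cemetery row of the absorbed matrix is zero, so this entry is constant in time. Hence the
    restriction to [L] is itself a semigroup. *)
Lemma mexp_absorbed_None t x : mexp (absorbed Q) t None (Some x) = 0.
Proof.
transitivity (mexp (absorbed Q) 0 None (Some x)); last by rewrite mexp0.
apply: (@is_derive_0_is_cst _ (fun s => mexp (absorbed Q) s None (Some x))) => s.
have := is_derive_mexpl (absorbed Q) s None (Some x).
by rewrite big1 // => z _; rewrite mul0r.
Qed.

Lemma subP0 y x : subP 0 y x = (y == x)%:R.
Proof. by rewrite /subP mexp0. Qed.

Lemma subPD s t y x : subP (s + t) y x = \sum_z subP s y z * subP t z x.
Proof.
by rewrite /subP mexpD sum_option mexp_absorbed_None mulr0 add0r.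
Qed.

Lemma is_derive_subP s y x : is_derive s (1 : R) (fun s => subP s y x)
  (\sum_w Q (Some y) (Some w) * subP s w x).
Proof.
have := is_derive_mexpl (absorbed Q) s (Some y) (Some x).
by rewrite sum_option mexp_absorbed_None mulr0 add0r.
Qed.

Lemma subP_ge0 t y x : 0 <= t -> 0 <= subP t y x.
Proof. exact: mexp_ge0 absorbed_rate _ _ _. Qed.

Lemma sum_subP t y : \sum_x subP t y x = 1 - mexp (absorbed Q) t (Some y) None.
Proof.
by apply/eqP; rewrite eq_sym subr_eq -(mexp_sum1 absorbed_rate t (Some y))
  sum_option addrC.
Qed.

Lemma sum_subP_le1 t y : 0 <= t -> \sum_x subP t y x <= 1.
Proof.
by move=> t0; rewrite sum_subP gerBl; apply: (mexp_ge0 absorbed_rate).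
Qed.

(** The diagonal entry alone gives a survival bound uniform in the starting point. *)
Lemma sum_subP_ge t y : 0 <= t ->
  expR (- (msize (absorbed Q) * t)) <= \sum_x subP t y x.
Proof.
move=> t0; rewrite (bigD1 y) //=.
apply: le_trans (mexp_diag_ge absorbed_rate (Some y) t0) _.
by rewrite lerDl sumr_ge0 // => x _; apply: subP_ge0.
Qed.

Lemma TtE t mu x : is_prob mu ->
  Tt Q t mu x = (\sum_y mu y * subP t y x) / (\sum_y mu y * \sum_z subP t y z).
Proof.
move=> [_ mu1]; rewrite /Tt; congr (_ / _).
under [RHS]eq_bigr => y _ do rewrite sum_subP mulrBr mulr1.
by rewrite sumrB mu1.
Qed.

Hypothesis hirrL : irreducible_rates (fun x y : L => Q (Some x) (Some y)).

Lemma subP_gt0 t y x : 0 < t -> 0 < subP t y x.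
Proof.
move=> t0; apply: (mexp_gt0 absorbed_rate) => //.
have /connectP [p hp ->] := hirrL y x.
elim: p y hp => //= z p IH y /andP[/andP[yz q] /IH h].
by apply: connect_trans h; apply: connect1; rewrite /= q andbT.
Qed.

(** Invariance at time 1 makes [nu] a left eigenvector of the positive matrix [subP 1], whose
    eigenvalue [rho] is the survival probability from [nu]. The contraction then acts along integer
    times, with constants independent of [mu]. *)
Lemma Tt_cvg_qsd nu : is_prob nu -> Tt Q 1 nu = nu ->
  forall e : R, 0 < e -> exists2 t, 0 < t &
    forall mu, is_prob mu -> tvdist (Tt Q t mu) nu <= e.
Proof.
move=> nuP hnu e e0; pose rho := \sum_y nu y * \sum_z subP 1 y z.
have rho0 : rho != 0.
  rewrite gt_eqF // (lt_le_trans (expR_gt0 (- (msize (absorbed Q) * 1)))) //.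
  rewrite -[leLHS]mul1r -[X in X * _ <= _]nuP.2 mulr_suml; apply: ler_sum => y _.
  by rewrite ler_wpM2l ?nuP.1 // sum_subP_ge.
have eig y : \sum_x nu x * subP 1 x y = rho * nu y.
  by rewrite -[in RHS]hnu TtE // mulrC divfK.
have [C [q [/andP[q0 q1] h]]] :=
  eigen_contraction (fun x y => subP_gt0 x y ltr01) nuP eig.
have : (fun n => C * q ^+ n) @ \oo --> (0 : R).
  by apply: cvg_geometric; rewrite ger0_norm.
move=> /cvgrPdist_le /(_ e e0) [N _ hN].
exists N.+1%:R => // mu muP.
have := hN N.+1 (leqnSn _); rewrite /= sub0r normrN => /(le_trans (ler_norm _)).
apply: le_trans.
pose r n x := \sum_y mu y * subP n%:R y x.
have -> : Tt Q N.+1%:R mu = fun x => r N.+1 x / \sum_y r N.+1 y.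
  apply/funext => x; rewrite TtE // /r exchange_big /=; congr (_ / _).
  by apply: eq_bigr => y _; rewrite mulr_sumr.
apply: h => [|n y]; rewrite /r.
- rewrite [X in is_prob X](_ : _ = mu) //; apply/funext => x.
  rewrite (bigD1 x) //= subP0 eqxx mulr1 big1 ?addr0 // => y /negPf yx.
  by rewrite subP0 yx mulr0.
- under [RHS]eq_bigr do rewrite mulr_suml.
  rewrite exchange_big; apply: eq_bigr => z _.
  rewrite -natr1 subPD mulr_sumr; apply: eq_bigr => w _.
  by rewrite mulrA.
Qed.

End Absorbed.
(** * The Fleming-Viot generator on functions of the empirical measure *)

Section Averages.
Variables (R : realType) (L : finType) (N : nat).
Implicit Types (f g : L -> R) (xi : conf L N).

Definition avg f xi : R := (\sum_(i < N) f (xi i)) / N%:R.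

Lemma sum_empirical f xi : \sum_y empirical R xi y * f y = avg f xi.
Proof.
rewrite /avg /empirical mulr_suml.
under eq_bigr => y _ do rewrite mulrAC mulr_suml.
under eq_bigr => y _ do rewrite mulr_suml.
rewrite exchange_big; apply: eq_bigr => i _ /=.
rewrite (bigD1 (xi i)) //= eqxx mul1r big1 ?addr0// => y /negPf yx.
by rewrite eq_sym yx !mul0r.
Qed.

Lemma avg_upd f xi i x :
  avg f (upd xi i x) = avg f xi + (f x - f (xi i)) / N%:R.
Proof.
rewrite /avg -mulrDl; congr (_ / _).
rewrite (bigD1 i) //= [in RHS](bigD1 i) //= ffunE eqxx.
under eq_bigr => j /negPf ji do rewrite ffunE ji.
by ring.
Qed.

Hypothesis N0 : (0 < N)%N.

Lemma avg_cst (c : R) xi : avg (fun=> c) xi = c.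
Proof.
by rewrite /avg sumr_const card_ord -[c *+ N]mulr_natr mulfK // pnatr_eq0 -lt0n.
Qed.

Lemma ler_avg f g xi : (forall y, f y <= g y) -> avg f xi <= avg g xi.
Proof. by move=> h; rewrite ler_wpM2r ?invr_ge0 // ler_sum. Qed.

Lemma avg_ge c f xi : (forall y, c <= f y) -> c <= avg f xi.
Proof. by move=> h; rewrite -[c](avg_cst _ xi) ler_avg. Qed.

Lemma avg_le c f xi : (forall y, f y <= c) -> avg f xi <= c.
Proof. by move=> h; rewrite -[c](avg_cst _ xi) ler_avg. Qed.

Lemma empirical_prob xi : is_prob (empirical R xi).
Proof.
split=> [x|]; first by rewrite divr_ge0 // sumr_ge0.
have := sum_empirical (fun=> 1) xi; rewrite avg_cst => <-.
by apply: eq_bigr => y _; rewrite mulr1.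
Qed.

Lemma is_derive_avg (F : R -> L -> R) (dF : L -> R) xi s :
  (forall y, is_derive s (1 : R) (F ^~ y) (dF y)) ->
  is_derive s (1 : R) (fun s => avg (F s) xi) (avg dF xi).
Proof.
move=> h; rewrite /avg.
have h1 : is_derive s (1 : R) (fun s => \sum_(i < N) F s (xi i))
    (\sum_(i < N) dF (xi i)).
  by apply: is_derive_sumT => i _.
have := is_deriveM h1 (is_derive_cst (N%:R^-1 : R) s (1 : R)) => h2.
by apply: is_derive_eq h2 _; rewrite /GRing.scale /= mulr0 add0r mulrC.
Qed.

End Averages.

(** * The generator acting on averages over particles *)

Section Generator.
Variables (R : realType) (L : finType) (Q : option L -> option L -> R).
Hypothesis hQ : is_rate_matrix Q.
Variable N : nat.
Hypothesis N2 : (2 <= N)%N.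
Implicit Types (xi : conf L N) (i : 'I_N) (x : L) (f g : L -> R).

Let N0 : (0 < N)%N. Proof. exact: ltnW. Qed.
Let N10 : 0 < N.-1%:R :> R. Proof. by rewrite ltr0n -subn1 subn_gt0. Qed.
Let NE : N%:R = N.-1%:R + 1 :> R. Proof. by rewrite natr1 prednK. Qed.

Definition jump_rate xi i x : R :=
  Q (Some (xi i)) (Some x)
    + Q (Some (xi i)) None * ((\sum_(j < N | j != i) (xi j == x)%:R) / N.-1%:R).

Lemma genFVE (F : conf L N -> R) xi : genFV Q F xi =
  \sum_i \sum_(x | x != xi i) jump_rate xi i x * (F (upd xi i x) - F xi).
Proof. by []. Qed.

Lemma jump_rate_ge0 xi i x : x != xi i -> 0 <= jump_rate xi i x.
Proof.
move=> h; rewrite addr_ge0 //; first by rewrite hQ.1 // eq_sym.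
by rewrite mulr_ge0 ?hQ.1 // divr_ge0 // sumr_ge0.
Qed.

Lemma sum_others xi i f :
  \sum_x (\sum_(j < N | j != i) (xi j == x)%:R) * f x =
  \sum_(j < N | j != i) f (xi j).
Proof.
under eq_bigr do rewrite mulr_suml.
rewrite exchange_big; apply: eq_bigr => j _ /=.
rewrite (bigD1 (xi j)) //= eqxx mul1r big1 ?addr0// => y /negPf yx.
by rewrite eq_sym yx mul0r.
Qed.

(** Relocation redistributes at most the killing rate, so the total is at most the exit rate, minus
    the diagonal entry of [Q]. *)
Lemma sum_jump_rate xi i :
  \sum_(x | x != xi i) jump_rate xi i x <= msize Q.
Proof.
have hs : \sum_(x | x != xi i) (\sum_(j < N | j != i) (xi j == x)%:R) <= N.-1%:R :> R.
  have <- : \sum_x (\sum_(j < N | j != i) (xi j == x)%:R) * 1 = N.-1%:R :> R.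
    by rewrite (sum_others xi i (fun=> 1)) sumr_const cardC1 card_ord.
  rewrite [leRHS](bigD1 (xi i)) //=; under [X in _ <= _ + X]eq_bigr do rewrite mulr1.
  by rewrite lerDr mulr1 sumr_ge0.
rewrite /jump_rate big_split /= -mulr_sumr -mulr_suml.
apply: (@le_trans _ _ (\sum_(x | x != xi i) Q (Some (xi i)) (Some x)
  + Q (Some (xi i)) None)).
  rewrite lerD2l ler_piMr ?hQ.1 //.
  by rewrite ler_pdivrMr // mul1r.
apply: le_trans (msize_ge Q (Some (xi i)) (Some (xi i))).
rewrite -normrN; apply: le_trans (ler_norm _).
have := hQ.2 (Some (xi i)); rewrite sum_option (bigD1 (xi i)) //= => h.
by lra.
Qed.

Lemma genFV_mx (F : conf L N -> R) xi :
  genFV Q F xi = \sum_eta genFVmx Q xi eta * F eta.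
Proof.
rewrite /genFVmx; under [RHS]eq_bigr do rewrite genFVE mulr_suml.
rewrite exchange_big genFVE; apply: eq_bigr => i _ /=.
under [RHS]eq_bigr do rewrite mulr_suml.
rewrite exchange_big; apply: eq_bigr => x _ /=.
under eq_bigr do rewrite -mulrA; rewrite -mulr_sumr; congr (_ * _).
under eq_bigr do rewrite mulrBl.
have h zeta : \sum_eta (zeta == eta)%:R * F eta = F zeta.
  rewrite (bigD1 zeta) //= eqxx mul1r big1 ?addr0// => y /negPf yx.
  by rewrite eq_sym yx mul0r.
by rewrite sumrB !h.
Qed.

(** Stated for every [N]: when [N.-1] is 0, the quotient in the relocation rate is 0 by
    convention. *)
Lemma genFVmx_rate : is_rate_matrix (@genFVmx R L Q N).
Proof.
split=> [xi eta xe|xi].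
  rewrite /genFVmx genFVE sumr_ge0 // => i _; rewrite sumr_ge0 // => x xx.
  by rewrite mulr_ge0 ?jump_rate_ge0 // (negPf xe) subr0.
have := genFV_mx (fun=> 1) xi.
under [RHS]eq_bigr do rewrite mulr1.
move=> <-; rewrite genFVE big1 // => i _; rewrite big1 // => x _.
by rewrite subrr mulr0.
Qed.

(** Relocation draws from the [N.-1] other particles; replacing their average by the full one
    produces the last term. *)
Lemma genFV_avg f xi : genFV Q (avg f) xi =
  avg (fun y => \sum_w Q (Some y) (Some w) * f w) xi
  + avg (fun y => Q (Some y) None) xi * avg f xi
  + (avg (fun y => Q (Some y) None) xi * avg f xi
     - avg (fun y => Q (Some y) None * f y) xi) / N.-1%:R.
Proof.
have NN : N%:R != 0 :> R by rewrite pnatr_eq0 -lt0n.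
have N1 : N.-1%:R != 0 :> R by rewrite gt_eqF.
have step i : \sum_(x | x != xi i) jump_rate xi i x * (avg f (upd xi i x) - avg f xi) =
  (\sum_w Q (Some (xi i)) (Some w) * f w
   + Q (Some (xi i)) None * avg f xi
   + (Q (Some (xi i)) None * avg f xi - Q (Some (xi i)) None * f (xi i)) / N.-1%:R)
   / N%:R.
  transitivity (\sum_x jump_rate xi i x * (f x - f (xi i)) / N%:R).
    rewrite [RHS](bigD1 (xi i)) //= subrr mulr0 mul0r add0r.
    by apply: eq_bigr => x _; rewrite avg_upd addrC addKr mulrA.
  rewrite -mulr_suml; congr (_ / _).
  under eq_bigr do rewrite /jump_rate mulrDl -!mulrA.
  rewrite big_split -mulr_sumr /=.
  under [X in _ + _ * X]eq_bigr do rewrite mulrCA.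
  rewrite -mulr_sumr (sum_others xi i (fun x => f x - f (xi i))).
  rewrite sumrB sumr_const cardC1 card_ord.
  have -> : \sum_(j < N | j != i) f (xi j) = N%:R * avg f xi - f (xi i).
    rewrite /avg mulrCA divff // mulr1 [in RHS](bigD1 i) //=.
    by rewrite [RHS]addrC addKr.
  under eq_bigr do rewrite mulrBr.
  rewrite sumrB -mulr_suml.
  (* The zero row sum turns the loss term of the internal jumps into a gain [Q y 0 * f y], with [y]
     the position of particle [i], which cancels the loss caused by relocation. *)
  have -> : \sum_w Q (Some (xi i)) (Some w) = - Q (Some (xi i)) None.
    by have /eqP := hQ.2 (Some (xi i)); rewrite sum_option addrC addr_eq0 => /eqP.
  rewrite -[f (xi i) *+ _]mulr_natr NE.
  by field.
rewrite genFVE; under eq_bigr do rewrite step.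
rewrite -mulr_suml big_split [X in (X + _) / _]big_split /=.
rewrite -!mulr_suml sumrB -mulr_suml.
by rewrite /avg; field; rewrite NN N1.
Qed.

End Generator.

(** * The generator acting on ratios of averages *)

Section Ratio.
Variables (R : realType) (L : finType) (Q : option L -> option L -> R).
Hypothesis hQ : is_rate_matrix Q.
Variable N : nat.
Hypothesis N2 : (2 <= N)%N.
Implicit Types (xi : conf L N) (i : 'I_N) (x : L).

Let N0 : (0 < N)%N. Proof. exact: ltnW. Qed.
Let Nr0 : 0 < N%:R :> R. Proof. by rewrite ltr0n. Qed.
Let N10 : 0 < N.-1%:R :> R. Proof. by rewrite ltr0n -subn1 subn_gt0. Qed.
Let N1N : N%:R^-1 <= N.-1%:R^-1 :> R.
Proof. by rewrite lef_pV2 ?posrE // ler_nat leq_pred. Qed.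

Variables (f g : L -> R) (d : R).
Hypothesis f_ge0 : forall y, 0 <= f y.
Hypothesis f_le : forall y, f y <= g y.
Hypothesis g_le1 : forall y, g y <= 1.
Hypothesis d_gt0 : 0 < d.
Hypothesis g_ge : forall y, d <= g y.

Let K := msize Q.
Let K0 : 0 <= K. Proof. exact: msize_ge0. Qed.

Definition avg_ratio xi := avg f xi / avg g xi.

Definition gen_sub (h : L -> R) y := \sum_w Q (Some y) (Some w) * h w.

(* With f = P_s phi and g = P_s 1 this is the time derivative of the ratio; the
   terms created by the relocated particles cancel because the ratio is
   homogeneous of degree 0 in (avg f, avg g). *)
Definition ratio_drift xi :=
  (avg (gen_sub f) xi - avg_ratio xi * avg (gen_sub g) xi) / avg g xi.

Let b_ge xi : d <= avg g xi. Proof. exact: avg_ge. Qed.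
Let b_gt0 xi : 0 < avg g xi. Proof. exact: lt_le_trans (b_ge xi). Qed.
Let a_ge0 xi : 0 <= avg f xi. Proof. exact: avg_ge. Qed.
Let a_le xi : avg f xi <= avg g xi. Proof. exact: ler_avg. Qed.
Let b_le1 xi : avg g xi <= 1. Proof. exact: avg_le. Qed.

Lemma ratio_ge0 xi : 0 <= avg_ratio xi.
Proof. by rewrite divr_ge0 // ltW. Qed.

Lemma ratio_le1 xi : avg_ratio xi <= 1.
Proof. by rewrite ler_pdivrMr // mul1r. Qed.

Let incr xi i x : R :=
  (f x - f (xi i)) / N%:R - avg_ratio xi * ((g x - g (xi i)) / N%:R).

(** An exact identity rather than an expansion: a'/b' - a/b = ((a' - a) - (a/b)(b' - b)) / b'. *)
Let incrE xi i x :
  avg_ratio (upd xi i x) - avg_ratio xi = incr xi i x / avg g (upd xi i x).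
Proof.
have h1 := b_gt0 xi; have h2 := b_gt0 (upd xi i x).
rewrite /incr /avg_ratio [avg f (upd _ _ _)]avg_upd.
have -> : (g x - g (xi i)) / N%:R = avg g (upd xi i x) - avg g xi.
  by rewrite avg_upd [RHS]addrC addKr.
by field; rewrite !gt_eqF.
Qed.

Let dg_le xi i x : `|(g x - g (xi i)) / N%:R| <= N%:R^-1.
Proof.
rewrite normrM normfV normr_nat ler_piMl ?invr_ge0 // ler_norml.
have := g_le1 x; have := g_le1 (xi i).
have := le_trans (f_ge0 x) (f_le x); have := le_trans (f_ge0 (xi i)) (f_le (xi i)).
by move=> *; apply/andP; split; lra.
Qed.

Let df_le xi i x : `|(f x - f (xi i)) / N%:R| <= N%:R^-1.
Proof.
rewrite normrM normfV normr_nat ler_piMl ?invr_ge0 // ler_norml.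
have := g_le1 x; have := g_le1 (xi i).
have := f_ge0 x; have := f_le x; have := f_ge0 (xi i); have := f_le (xi i).
by move=> *; apply/andP; split; lra.
Qed.

Let incr_le xi i x : `|incr xi i x| <= 2 / N%:R.
Proof.
apply: le_trans (ler_normB _ _) _; rewrite mulr_natl mulr2n lerD ?df_le //.
rewrite normrM ger0_norm ?ratio_ge0 //.
by rewrite -[leRHS]mul1r ler_pM ?ratio_ge0 ?ratio_le1 ?dg_le.
Qed.

Let b_inv xi : (avg g xi)^-1 <= d^-1.
Proof. by rewrite lef_pV2 ?posrE. Qed.

(** Each of the [N] particles jumps at total rate at most [K], so summands of order 1/N^2 contribute
    O(1/N). *)
Let sum_rates_le xi (F : 'I_N -> L -> R) (c : R) : 0 <= c ->
  (forall i x, `|F i x| <= c) ->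
  `|\sum_i \sum_(x | x != xi i) jump_rate Q xi i x * F i x| <= N%:R * K * c.
Proof.
move=> c0 hF; apply: le_trans (ler_norm_sum _ _ _) _.
apply: (@le_trans _ _ (\sum_(i < N) K * c)); last first.
  by rewrite sumr_const card_ord -mulrA [leRHS]mulr_natl.
apply: ler_sum => i _; apply: le_trans (ler_norm_sum _ _ _) _.
apply: (@le_trans _ _ (\sum_(x | x != xi i) jump_rate Q xi i x * c)).
  apply: ler_sum => x xx; rewrite normrM ger0_norm ?jump_rate_ge0 //.
  by rewrite ler_wpM2l ?jump_rate_ge0.
by rewrite -mulr_suml ler_wpM2r // sum_jump_rate.
Qed.

(** The carre du champ of the ratio, normalized as L(r^2) - 2 r L(r). *)
Let gamma xi := \sum_i \sum_(x | x != xi i)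
  jump_rate Q xi i x * (avg_ratio (upd xi i x) - avg_ratio xi) ^+ 2.

Let gamma_le xi : `|gamma xi| <= 4 * K / d ^+ 2 / N.-1%:R.
Proof.
apply: (@le_trans _ _ (N%:R * K * (2 / N%:R / d) ^+ 2)).
  apply: sum_rates_le => [|i x]; first exact: sqr_ge0.
  rewrite normrX lerXn2r ?qualifE //=; first by rewrite !divr_ge0 // ltW.
  rewrite incrE normrM normfV [`|avg _ _|]gtr0_norm //.
  by rewrite ler_pM ?invr_ge0 // ltW.
have -> : N%:R * K * (2 / N%:R / d) ^+ 2 = 4 * K / d ^+ 2 / N%:R.
  by field; rewrite !gt_eqF.
by rewrite ler_wpM2l // divr_ge0 ?sqr_ge0 ?mulr_ge0.
Qed.

Lemma genFV_ratio_drift xi :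
  `|genFV Q avg_ratio xi - ratio_drift xi| <= 4 * K / d ^+ 2 / N.-1%:R.
Proof.
have bx := b_gt0 xi; have bN := negbT (gt_eqF bx).
have NN := negbT (gt_eqF Nr0); have N1 := negbT (gt_eqF N10).
(* Cost of replacing the updated denominator b' by b in [incrE], from 1/b' = 1/b - (b' - b)/(b b');
   it is of second order in 1/N. *)
pose err i x :=
  - incr xi i x * ((g x - g (xi i)) / N%:R) / (avg g xi * avg g (upd xi i x)).
have -> : genFV Q avg_ratio xi =
   (genFV Q (avg f) xi - avg_ratio xi * genFV Q (avg g) xi) / avg g xi
   + \sum_i \sum_(x | x != xi i) jump_rate Q xi i x * err i x.
  rewrite !genFVE mulr_sumr -sumrB mulr_suml -big_split; apply: eq_bigr => i _.
  rewrite mulr_sumr -sumrB mulr_suml -big_split; apply: eq_bigr => x _ /=.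
  rewrite incrE /err.
  have -> : avg f (upd xi i x) - avg f xi = (f x - f (xi i)) / N%:R.
    by rewrite avg_upd addrC addKr.
  have e : avg g (upd xi i x) - avg g xi = (g x - g (xi i)) / N%:R.
    by rewrite avg_upd addrC addKr.
  rewrite -e /incr -e.
  have h2 := b_gt0 (upd xi i x).
  by field; rewrite bN gt_eqF.
rewrite !genFV_avg //.
set q0 := fun y => Q (Some y) None.
set af := avg (fun y => _ * f y) xi; set ag := avg (fun y => _ * g y) xi.
set k := avg q0 xi.
have q0_ge y : 0 <= q0 y by exact: hQ.1.
have q0_le y : q0 y <= K by apply: le_trans (msize_ge Q (Some y) None); apply: ler_norm.
have dom h : (forall y, 0 <= h y <= 1) ->
    `|k * avg h xi - avg (fun y => q0 y * h y) xi| <= K.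
  move=> hh.
  have h1 : 0 <= avg h xi <= 1.
    by rewrite avg_ge ?avg_le // => y; case/andP: (hh y).
  have k1 : 0 <= k <= K by rewrite avg_ge ?avg_le.
  have h2 : 0 <= avg (fun y => q0 y * h y) xi.
    by apply: avg_ge => // y; rewrite mulr_ge0 //; case/andP: (hh y).
  have h3 : avg (fun y => q0 y * h y) xi <= K.
    apply: avg_le => // y; rewrite -[K]mulr1; case/andP: (hh y) => ? ?.
    by rewrite ler_pM.
  have h4 : 0 <= k * avg h xi <= K.
    case/andP: k1 h1 => ? ? /andP[? ?].
    by rewrite mulr_ge0 //= -[K]mulr1 ler_pM.
  by case/andP: h4 => ? ?; rewrite ler_norml; apply/andP; split; lra.
have df : `|k * avg f xi - af| <= K.
  by apply: dom => y; rewrite f_ge0 (le_trans (f_le y)).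
have dg : `|k * avg g xi - ag| <= K.
  by apply: dom => y; rewrite g_le1 (le_trans (f_ge0 y)).
set E := \sum_i \sum_(x | _) jump_rate Q xi i x * err i x.
have hE : `|E| <= 2 * K / d ^+ 2 / N.-1%:R.
  apply: (@le_trans _ _ (N%:R * K * (2 / N%:R * N%:R^-1 / d ^+ 2))).
    apply: sum_rates_le => [|i x].
      by rewrite divr_ge0 ?sqr_ge0 // mulr_ge0 ?invr_ge0 // divr_ge0.
    have bb : 0 < avg g xi * avg g (upd xi i x) by rewrite (mulr_gt0 (b_gt0 _)).
    rewrite /err normrM normfV [`|avg g xi * _|]gtr0_norm // normrM normrN expr2.
    rewrite [(avg g xi * _)^-1]invfM [(d * d)^-1]invfM.
    apply: ler_pM; [exact: mulr_ge0| |exact: ler_pM|].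
      by rewrite mulr_ge0 // invr_ge0 ltW.
    by apply: ler_pM; rewrite ?b_inv // invr_ge0 ltW.
  have -> : N%:R * K * (2 / N%:R * N%:R^-1 / d ^+ 2) = 2 * K / d ^+ 2 / N%:R.
    by field; rewrite NN gt_eqF.
  by rewrite ler_wpM2l // divr_ge0 ?sqr_ge0 ?mulr_ge0.
(* The drifts [k * avg f] and [k * avg g] cancel in the ratio; only their corrections of order
   [1 / N.-1] survive. *)
have -> : forall A B : R,
  (A + k * avg f xi + (k * avg f xi - af) / N.-1%:R
   - avg_ratio xi * (B + k * avg g xi + (k * avg g xi - ag) / N.-1%:R)) / avg g xi
   + E - (A - avg_ratio xi * B) / avg g xi =
  ((k * avg f xi - af) - avg_ratio xi * (k * avg g xi - ag)) / avg g xi / N.-1%:R + E.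
  by move=> A B; rewrite /avg_ratio; field; rewrite bN N1.
apply: le_trans (ler_normD _ _) _.
have -> : 4 * K / d ^+ 2 / N.-1%:R =
    2 * K / d ^+ 2 / N.-1%:R + 2 * K / d ^+ 2 / N.-1%:R.
  by field; rewrite N1 gt_eqF.
apply: lerD => //; rewrite normrM [`|N.-1%:R^-1|]gtr0_norm ?invr_gt0 //.
rewrite ler_wpM2r ?invr_ge0 ?(ltW N10) // normrM normfV [`|avg _ _|]gtr0_norm //.
(* [d] lies below an average that is at most 1, so the corrections can share the denominator
   [d ^+ 2] of the second order error. *)
have dd : d^-1 <= d^-2.
  have d1 : d <= 1 by exact: le_trans (b_ge xi) (b_le1 xi).
  rewrite lef_pV2 ?posrE ?exprn_gt0 //.
  by rewrite expr2 ler_piMl // ltW.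
apply: ler_pM => //; first by rewrite invr_ge0 ltW.
  apply: le_trans (ler_normB _ _) _.
  rewrite mulr_natl mulr2n lerD // normrM ger0_norm ?ratio_ge0 //.
  by rewrite -[K]mul1r ler_pM ?ratio_ge0 ?ratio_le1.
exact: le_trans dd.
Qed.

(** With u = r - c one has L(u^2) = 2 u L(u) + [gamma]. Since |u| <= 1, the errors add up to 2 * 4 +
    4 = 12. *)
Lemma genFV_ratio_sqr (c : R) xi : 0 <= c <= 1 ->
  `|2 * (avg_ratio xi - c) * ratio_drift xi
    - genFV Q (fun eta => (avg_ratio eta - c) ^+ 2) xi| <= 12 * K / d ^+ 2 / N.-1%:R.
Proof.
move=> /andP[c0 c1].
have -> : genFV Q (fun eta => (avg_ratio eta - c) ^+ 2) xi =
    2 * (avg_ratio xi - c) * genFV Q avg_ratio xi + gamma xi.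
  rewrite !genFVE /gamma mulr_sumr -big_split; apply: eq_bigr => i _ /=.
  by rewrite mulr_sumr -big_split; apply: eq_bigr => x _ /=; ring.
have -> : 2 * (avg_ratio xi - c) * ratio_drift xi
    - (2 * (avg_ratio xi - c) * genFV Q avg_ratio xi + gamma xi) =
  - (2 * (avg_ratio xi - c) * (genFV Q avg_ratio xi - ratio_drift xi)) - gamma xi by ring.
apply: le_trans (ler_normB _ _) _; rewrite normrN.
have -> : 12 * K / d ^+ 2 / N.-1%:R =
    2 * (4 * K / d ^+ 2 / N.-1%:R) + 4 * K / d ^+ 2 / N.-1%:R.
  by field; rewrite !gt_eqF.
apply: lerD => //; rewrite normrM ler_pM ?genFV_ratio_drift //.
rewrite normrM normr_nat ler_piMr // ler_norml.
have := ratio_ge0 xi; have := ratio_le1 xi.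
by move=> *; apply/andP; split; lra.
Qed.

End Ratio.
(** * Mean-field limit *)

(** The parameter [e] is free of [N]: it is fixed first to make the first term small, and [N] then
    absorbs the second. *)
Lemma cvg0_tradeoff (R : realType) (u : nat -> R) (c D : R) :
  (forall N, (2 <= N)%N -> 0 <= u N) -> 0 <= c -> 0 <= D ->
  (forall e N, 0 < e -> (2 <= N)%N -> u N <= c * (e + D / N.-1%:R / e)) ->
  u @ \oo --> 0.
Proof.
move=> u0 c0 D0 hu; apply/cvgrPdist_le => e e0.
(* The shift to [c + 1] keeps the quotient meaningful when [c = 0]. *)
pose e1 := e / (2 * (c + 1)).
have c1 : 0 < c + 1 by lra.
have e10 : 0 < e1 by rewrite divr_gt0 // mulr_gt0.
pose M := (Num.Def.trunc (D / e1 ^+ 2)).+1.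
exists (maxn 2 M.+1) => // N /=; rewrite geq_max => /andP[N2 NM].
have N10 : 0 < N.-1%:R :> R by rewrite ltr0n -subn1 subn_gt0.
rewrite sub0r normrN ger0_norm ?u0 //; apply: le_trans (hu _ _ e10 N2) _.
have hD : D / N.-1%:R / e1 <= e1.
  rewrite ler_pdivrMr // -expr2 ler_pdivrMr // mulrC -ler_pdivrMr ?exprn_gt0 //.
  apply: (@le_trans _ _ M%:R); first exact/ltW/truncnS_gt.
  by rewrite ler_nat -ltnS prednK // ltnW.
apply: (@le_trans _ _ (c * (e1 + e1))); first by rewrite ler_wpM2l // lerD2l.
have -> : c * (e1 + e1) = e * (c / (c + 1)) by rewrite /e1; field; rewrite gt_eqF.
rewrite ler_piMr ?ler_pdivrMr ?mul1r // ?(ltW e0) //; lra.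
Qed.

Section MeanField.
Variables (R : realType) (L : finType) (Q : option L -> option L -> R).
Hypothesis hQ : is_rate_matrix Q.

(** The constant of [genFV_ratio_sqr], with [d] the survival bound at time [t], multiplied by the
    length of the time interval. *)
Definition fv_const (t : R) : R :=
  12 * msize Q / expR (- (msize (absorbed Q) * t)) ^+ 2 * t.

Lemma fv_const_ge0 t : 0 <= t -> 0 <= fv_const t.
Proof.
move=> t0; rewrite /fv_const; apply: mulr_ge0 => //; apply: divr_ge0.
  by rewrite mulr_ge0 // msize_ge0.
exact: sqr_ge0.
Qed.

Lemma expFV_ge0 N (t : R) (xi : conf L N) (F : conf L N -> R) : 0 <= t ->
  (forall eta, 0 <= F eta) -> 0 <= expFV Q t xi F.
Proof.
move=> t0 hF; apply: sumr_ge0 => eta _.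
by rewrite mulr_ge0 // (mexp_ge0 (genFVmx_rate hQ N)).
Qed.

Lemma expFV_le N (t : R) (xi : conf L N) (F G : conf L N -> R) : 0 <= t ->
  (forall eta, F eta <= G eta) -> expFV Q t xi F <= expFV Q t xi G.
Proof.
move=> t0 hF; apply: ler_sum => eta _.
by rewrite ler_wpM2l // (mexp_ge0 (genFVmx_rate hQ N)).
Qed.

Lemma expFV_sqr N (t : R) (xi : conf L N) x : (2 <= N)%N -> 0 <= t ->
  expFV Q t xi (fun eta =>
    (empirical R eta x - Tt Q t (empirical R xi) x) ^+ 2)
  <= fv_const t / N.-1%:R.
Proof.
move=> N2 t0; have N0 : (0 < N)%N by exact: ltnW.
(* The test function is the indicator of [x]: at [s = 0] the ratio is [empirical R eta x], at
   [s = t] it is [Tt]. *)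
pose f s y := subP Q s y x; pose g s y := \sum_z subP Q s y z.
pose d := expR (- (msize (absorbed Q) * t)).
have d0 : 0 < d by exact: expR_gt0.
have f_ge0 s : 0 <= s -> forall y, 0 <= f s y by move=> s0 y; apply: subP_ge0.
have f_le s : 0 <= s -> forall y, f s y <= g s y.
  move=> s0 y; rewrite /g (bigD1 x) //= lerDl sumr_ge0 // => z _.
  exact: subP_ge0.
have g_le1 s : 0 <= s -> forall y, g s y <= 1.
  by move=> s0 y; apply: sum_subP_le1.
have g_ge s : 0 <= s <= t -> forall y, d <= g s y.
  move=> /andP[s0 st] y; apply: le_trans (sum_subP_ge hQ y s0).
  by rewrite ler_expR lerN2 ler_wpM2l // msize_ge0.
have b_gt0 s eta : 0 <= s <= t -> 0 < @avg R L N (g s) eta.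
  by move=> hs; rewrite (lt_le_trans d0) // avg_ge //; apply: g_ge.
pose r s : conf L N -> R := avg_ratio (f s) (g s).
have TtE' : Tt Q t (empirical R xi) x = r t xi.
  by rewrite TtE ?sum_empirical //; apply: empirical_prob.
set c := Tt Q t _ x in TtE' *.
have c01 : 0 <= c <= 1.
  rewrite TtE' (ratio_ge0 N2 _ d0) ?(ratio_le1 N2 _ d0) //;
  by [apply: f_le|apply: g_ge; rewrite t0 lexx|apply: f_ge0].
(* c = r_t(xi), so F_t vanishes at xi, whereas F_0 is the squared error. *)
pose F s (eta : conf L N) := (r s eta - c) ^+ 2.
have dr s eta : 0 <= s <= t ->
    is_derive s (1 : R) (fun s => r s eta) (ratio_drift Q (f s) (g s) eta).
  move=> hs.
  have da := is_derive_avg eta (fun y => is_derive_subP Q s y x).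
  have dg y : is_derive s (1 : R) (fun s => g s y) (gen_sub Q (g s) y).
    have -> : gen_sub Q (g s) y =
        \sum_z \sum_w Q (Some y) (Some w) * subP Q s w z.
      by rewrite /gen_sub exchange_big; apply: eq_bigr => w _; rewrite mulr_sumr.
    by apply: is_derive_sumT => z _; apply: is_derive_subP.
  have db := is_derive_avg eta dg.
  have bn : avg (g s) eta != 0 by rewrite gt_eqF // b_gt0.
  have dbV := @is_deriveV R (fun s => avg (g s) eta) s _ _ bn db.
  have := is_deriveM da dbV => h; apply: is_derive_eq h _.
  rewrite /ratio_drift /avg_ratio /GRing.scale /=.
  by field.
have dF s eta : 0 <= s <= t -> is_derive s (1 : R) (F ^~ eta)
    (2 * (r s eta - c) * ratio_drift Q (f s) (g s) eta).
  move=> hs.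
  have h1 : is_derive s (1 : R) (fun s => r s eta - c)
      (ratio_drift Q (f s) (g s) eta).
    have h := is_deriveB (dr s eta hs) (is_derive_cst c s (1 : R)).
    by apply: is_derive_eq h _; rewrite subr0.
  have := is_deriveM h1 h1 => h; apply: is_derive_eq h _.
  by rewrite /GRing.scale /=; ring.
(* By Duhamel, the derivative of [G] averages the defect of [F], which [genFV_ratio_sqr] bounds
   uniformly in the configuration. *)
pose G s := \sum_eta mexp (@genFVmx R L Q N) (t - s) xi eta * F s eta.
have Gt : G t = 0.
  rewrite /G subrr (bigD1 xi) //= mexp0 eqxx mul1r big1 => [|y /negPf yx].
    by rewrite addr0 /F TtE' subrr expr0n.
  by rewrite mexp0 eq_sym yx mul0r.
have G0 : G 0 = expFV Q t xi (fun eta => (empirical R eta x - c) ^+ 2).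
  rewrite /G subr0; apply: eq_bigr => eta _; congr (_ * (_ - _) ^+ 2); rewrite /r.
  have -> : g 0 = (fun=> 1).
    apply/funext => y; rewrite /g (bigD1 y) //= subP0 eqxx big1 ?addr0 //.
    move=> z /negPf zy.
    by rewrite subP0 eq_sym zy.
  have -> : f 0 = (fun y => (y == x)%:R).
    by apply/funext => y; rewrite /f subP0.
  by rewrite /avg_ratio avg_cst // divr1.
suff : `|G t - G 0| <= 12 * msize Q / d ^+ 2 / N.-1%:R * (t - 0).
  rewrite Gt G0 sub0r normrN subr0 => /(le_trans (ler_norm _)).
  by rewrite /fv_const -/d mulrAC.
apply: (is_derive_bound t0) => s hs.
  by apply: is_derive_duhamel => eta; apply: dF.
have ts : 0 <= t - s by rewrite subr_ge0; case/andP: hs.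
have s0 : 0 <= s by case/andP: hs.
apply: le_trans (ler_norm_sum _ _ _) _.
rewrite -[leRHS]mul1r.
rewrite -[X in _ <= X * _](mexp_sum1 (genFVmx_rate hQ N) (t - s) xi) mulr_suml.
apply: ler_sum => eta _; rewrite normrM ger0_norm ?(mexp_ge0 (genFVmx_rate hQ N)) //.
rewrite ler_wpM2l ?(mexp_ge0 (genFVmx_rate hQ N)) // -genFV_mx.
exact: (genFV_ratio_sqr hQ N2 (f_ge0 s s0) (f_le s s0) (g_le1 s s0) d0
  (g_ge s hs) eta c01).
Qed.

(** The inequality |X| <= e + X^2 / e passes from the mean square to the mean absolute error without
    square roots; summing over sites gives [#|L|]. *)
Lemma expFV_tvdist N (t : R) (xi : conf L N) (e : R) : (2 <= N)%N -> 0 <= t -> 0 < e ->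
  expFV Q t xi (fun eta => tvdist (empirical R eta) (Tt Q t (empirical R xi)))
  <= #|L|%:R * (e + fv_const t / N.-1%:R / e).
Proof.
move=> N2 t0 e0.
have -> : expFV Q t xi (fun eta => tvdist (empirical R eta) (Tt Q t (empirical R xi))) =
    \sum_x expFV Q t xi (fun eta => `|empirical R eta x - Tt Q t (empirical R xi) x|).
  rewrite /expFV exchange_big /=; apply: eq_bigr => eta _.
  by rewrite mulr_sumr.
rewrite mulr_natl -sumr_const; apply: ler_sum => x _.
have amgm (X : R) : `|X| <= e + X ^+ 2 / e.
  rewrite -(ler_pM2r e0) mulrDl divfK ?gt_eqF // -[X ^+ 2]real_normK ?num_real //.
  have := sqr_ge0 (`|X| - e / 2); have := sqr_ge0 e; nra.
apply: le_trans (expFV_le xi t0 (fun eta => amgm _)) _.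
rewrite /expFV; under eq_bigr do rewrite mulrDr mulrA.
rewrite big_split /= -!mulr_suml (mexp_sum1 (genFVmx_rate hQ N)) mul1r lerD2l.
by rewrite ler_wpM2r ?invr_ge0 ?(ltW e0) // expFV_sqr.
Qed.

(** Stationarity tested on indicators says that [lam] annihilates the generator matrix, so
    [mexp_stationary] applies. *)
Lemma expFV_stationary N (t : R) (lam F : conf L N -> R) :
  is_stationaryFV Q lam ->
  \sum_xi lam xi * expFV Q t xi F = \sum_xi lam xi * F xi.
Proof.
move=> [_ h]; rewrite /expFV.
under eq_bigr do rewrite mulr_sumr.
rewrite exchange_big; apply: eq_bigr => eta _ /=.
under eq_bigr do rewrite mulrA.
rewrite -mulr_suml; congr (_ * _).
by apply: mexp_stationary => zeta; apply: h.
Qed.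

End MeanField.

Lemma tvdist_triangle (R : realType) (L : finType) (m1 m2 m3 : L -> R) :
  tvdist m1 m3 <= tvdist m1 m2 + tvdist m2 m3.
Proof.
by rewrite /tvdist -big_split; apply: ler_sum => x _; apply: ler_distD.
Qed.

Theorem theorem1p5 (R : realType) (L : finType)
  (Q : option L -> option L -> R)
  (hQ : is_rate_matrix Q)
  (hirr : irreducible_rates Q)
  (hirrL : irreducible_rates (fun x y : L => Q (Some x) (Some y)))
  (nu : L -> R) (hnu : is_prob nu)
  (hqsd : forall t : R, 0 <= t -> Tt Q t nu = nu)
  (lam : forall N : nat, conf L N -> R)
  (hlam : forall N : nat, (2 <= N)%N -> is_stationaryFV Q (lam N)) :
  (forall t : R, 0 < t ->
     (fun N : nat =>
        \big[Num.max/0]_(xi : conf L N)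
           expFV Q t xi (fun eta => tvdist (@empirical R L N eta) (Tt Q t (@empirical R L N xi))))
     @ \oo --> 0)
  /\
  (fun N : nat => \sum_(xi : conf L N) lam N xi * tvdist (@empirical R L N xi) nu) @ \oo --> 0.
Proof.
split=> [t t0|].
  apply: (cvg0_tradeoff (c := #|L|%:R) (D := fv_const Q t)) => //.
  - by move=> N _; apply: bigmax_ge_id.
  - exact/fv_const_ge0/ltW.
  (* The maximum has default value 0, which must lie below the bound as well. *)
  - move=> e N e0 N2; apply/bigmax_leP; split.
      rewrite mulr_ge0 // addr_ge0 // ?(ltW e0) // divr_ge0 ?(ltW e0) //.
      by rewrite divr_ge0 // fv_const_ge0 // ltW.
    by move=> xi _; apply: expFV_tvdist => //; apply: ltW.
have lam_ge0 N : (2 <= N)%N ->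
    0 <= \sum_(xi : conf L N) lam N xi * tvdist (@empirical R L N xi) nu.
  move=> N2; apply: sumr_ge0 => xi _; rewrite mulr_ge0 ?sumr_ge0 //.
  by have [[h _] _] := hlam N N2.
apply/cvgrPdist_le => e e0; have e2 : 0 < e / 2 by rewrite divr_gt0.
(* One time [t] brings [Tt] within [e / 2] of [nu] from every initial law, in particular from every
   empirical measure. *)
have [t t0 ht] := Tt_cvg_qsd hQ hirrL hnu (hqsd 1 ler01) e2.
have tv0 : (fun N => \sum_(xi : conf L N) lam N xi *
    expFV Q t xi (fun eta => tvdist (@empirical R L N eta)
      (Tt Q t (@empirical R L N xi)))) @ \oo --> 0.
  apply: (cvg0_tradeoff (c := #|L|%:R) (D := fv_const Q t)) => //.
  - move=> N N2; apply: sumr_ge0 => xi _.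
    have [[h _] _] := hlam N N2; rewrite mulr_ge0 // expFV_ge0 ?(ltW t0) //.
    by move=> eta; apply: sumr_ge0.
  - exact/fv_const_ge0/ltW.
  - move=> e' N e'0 N2; have [[h h1] _] := hlam N N2.
    rewrite -[leRHS]mul1r -[X in _ <= X * _]h1 mulr_suml; apply: ler_sum => xi _.
    by rewrite ler_wpM2l // expFV_tvdist // ltW.
move/cvgrPdist_le: tv0 => /(_ _ e2) [M _ hM].
exists (maxn 2 M) => // N /=; rewrite geq_max => /andP[N2 NM].
rewrite sub0r normrN ger0_norm ?lam_ge0 //.
have [[h h1] _] := hlam N N2.
(* Stationarity lets the system run for time [t] before the distance to [nu] is measured. *)
rewrite -(expFV_stationary t _ (hlam N N2)).
have := hM N NM; rewrite /= sub0r normrN => /(le_trans (ler_norm _)) hN.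
rewrite [leRHS](_ : e = e / 2 + e / 2); last by field.
have -> : e / 2 + e / 2 = e / 2 + 1 * (e / 2) by rewrite mul1r.
apply: le_trans (lerD hN (lexx _)).
rewrite -[X in _ <= _ + X * _]h1 mulr_suml -big_split; apply: ler_sum => xi _ /=.
rewrite -mulrDr ler_wpM2l // -[e / 2]mul1r.
rewrite -[X in _ + X * _](mexp_sum1 (genFVmx_rate hQ N) t xi) mulr_suml -big_split.
apply: ler_sum => eta _ /=; rewrite -mulrDr ler_wpM2l //.
  by rewrite (mexp_ge0 (genFVmx_rate hQ N)) // ltW.
(* The intermediate point is the conditioned evolution of the initial empirical measure. *)
apply: le_trans (tvdist_triangle _ (Tt Q t (empirical R xi)) _) _.
by rewrite lerD2l; apply/ht/empirical_prob/ltnW.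
Qed.
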